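(* Let $\Pi=(V_p,V_r,L,\ell_{\mathrm{init}},\ell_{\mathrm{out}},\mu_{\mathrm{init}},\mathcal D,\mathfrak T)$ be a score-at-end WPTS. Let $h:L\times\mathbb{R}^{|V_p|}\to\mathbb{R}$ be a bounded function (i.e. $\sup|h|<\infty$). If $h$ is a potential upper weight function (PUWF), then for every $\mathbf v_{\mathrm{init}}\in\operatorname{supp}\mu_{\mathrm{init}}$ we have $[\![\Pi]\!]_{\mathbf v_{\mathrm{init}}}(\mathbb{R}^{|V_p|})\le h(\ell_{\mathrm{init}},\mathbf v_{\mathrm{init}})$. If $h$ is a potential lower weight function (PLWF), then for every $\mathbf v_{\mathrm{init}}\in\operatorname{supp}\mu_{\mathrm{init}}$ we have $[\![\Pi]\!]_{\mathbf v_{\mathrm{init}}}(\mathbb{R}^{|V_p|})\ge h(\ell_{\mathrm{init}},\mathbf v_{\mathrm{init}})$.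
   Context: A weighted probabilistic transition system (WPTS) is a tuple $\Pi=(V_p,V_r,L,\ell_{\mathrm{init}},\ell_{\mathrm{out}},\mu_{\mathrm{init}},\mathcal D,\mathfrak T)$ where: $V_p$ (program variables) and $V_r$ (sampling variables) are finite disjoint sets; a program valuation is $\mathbf v\in\mathbb{R}^{|V_p|}$ and a sampling valuation is $\mathbf r\in\mathbb{R}^{|V_r|}$; $L$ is a finite set of locations with $\ell_{\mathrm{init}},\ell_{\mathrm{out}}\in L$; $\mu_{\mathrm{init}}$ is a probability distribution on $\mathbb{R}^{|V_p|}$ with bounded support; $\mathcal D$ is a product probability distribution on $\mathbb{R}^{|V_r|}$ (each sampling variable independently distributed); $\mathfrak T$ is a finite set of transitions $\tau=\langle \ell,\phi,F_1,\dots,F_k\rangle$ with source location $\ell\neq\ell_{\mathrm{out}}$, guard $\phi$ (a measurable predicate on program valuations) and forks $F_j=\langle \ell'_j,p_j,\mathrm{upd}_j,\mathrm{wt}_j\rangle$, where $\ell'_j\in L$, $p_j\in(0,1]$ with $\sum_j p_j=1$, $\mathrm{upd}_j:\mathbb{R}^{|V_p|}\times\mathbb{R}^{|V_r|}\to\mathbb{R}^{|V_p|}$ measurable (update function) and $\mathrm{wt}_j:\mathbb{R}^{|V_p|}\times\mathbb{R}^{|V_r|}\to[0,\infty)$ measurable (score function). The WPTS is deterministic and total: for every location $\ell\ne\ell_{\mathrm{out}}$ and valuation $\mathbf v$ there is exactly one transition with source $\ell$ whose guard $\mathbf v$ satisfies. Semantics: from a state $(\ell,\mathbf v)$ the run starts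 with weighted state $(\ell,\mathbf v,1)$. From a weighted state $(\ell_n,\mathbf v_n,w_n)$: if $\ell_n=\ell_{\mathrm{out}}$ the next weighted state is the same; otherwise take the unique enabled transition $\langle\ell_n,\phi,F_1,\dots,F_k\rangle$, choose fork $j$ with probability $p_j$, sample $\mathbf r\sim\mathcal D$ independently, and move to $(\ell'_j,\mathrm{upd}_j(\mathbf v_n,\mathbf r),w_n\cdot\mathrm{wt}_j(\mathbf v_n,\mathbf r))$. $\mathbb P_{(\ell,\mathbf v)},\mathbb E_{(\ell,\mathbf v)}$ denote the induced probability and expectation on runs; for an initial valuation $\mathbf v$ we write $\mathbb P_{\mathbf v},\mathbb E_{\mathbf v}$ for the case $\ell=\ell_{\mathrm{init}}$. The termination time is $T=\min\{n:\ell_n=\ell_{\mathrm{out}}\}$ ($\min\emptyset=\infty$); $\hat{\mathbf v}_T,\hat w_T$ are the valuation and weight at termination. A state $(\ell,\mathbf v)$ is reachable if it occurs in some run starting from $(\ell_{\mathrm{init}},\mathbf v_0)$ with $\mathbf v_0\in\operatorname{supp}\mu_{\mathrm{init}}$. $\Pi$ is almost-surely terminating (AST) if $\mathbb P_{\mathbf v}(T<\infty)=1$ for all $\mathbf v\in\operatorname{supp}\mu_{\mathrm{init}}$. For measurable $U\subseteq\mathbb{R}^{|V_p|}$, the expected weight is $[\![\Pi]\!]_{\mathbf v}(U):=\mathbb E_{\mathbf v}[\mathbf 1_{T<\infty}\,[\hat{\mathbf v}_T\in U]\,\hat w_T]$. $\Pi$ is score-at-end if: (i) it is AST; (ii) exactly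 one transition has a fork with destination $\ell_{\mathrm{out}}$, and that transition has the form $\langle\ell,\phi,F\rangle$ with a single fork $F=\langle\ell_{\mathrm{out}},1,\mathrm{id},\mathrm{wt}\rangle$ where $\mathrm{id}(\mathbf v,\mathbf r)=\mathbf v$ and $0\le\mathrm{wt}\le M$ for some constant $M>0$; (iii) every other fork has score function constantly $1$. The expected-weight transformer maps $h:L\times\mathbb{R}^{|V_p|}\to\mathbb{R}$ to $\mathrm{ewt}(h)$ with $\mathrm{ewt}(h)(\ell_{\mathrm{out}},\mathbf v)=1$ and, for $\ell\ne\ell_{\mathrm{out}}$ with unique enabled transition $\langle\ell,\phi,F_1,\dots,F_k\rangle$, $F_j=\langle\ell'_j,p_j,\mathrm{upd}_j,\mathrm{wt}_j\rangle$: $\mathrm{ewt}(h)(\ell,\mathbf v)=\sum_{j=1}^k p_j\,\mathbb E_{\mathbf r\sim\mathcal D}[\mathrm{wt}_j(\mathbf v,\mathbf r)\,h(\ell'_j,\mathrm{upd}_j(\mathbf v,\mathbf r))]$. A PUWF is a function $h:L\times\mathbb{R}^{|V_p|}\to\mathbb{R}$ such that (C1) $\mathrm{ewt}(h)(\ell,\mathbf v)\le h(\ell,\mathbf v)$ for all reachable states $(\ell,\mathbf v)$ with $\ell\ne\ell_{\mathrm{out}}$, and (C2) $h(\ell_{\mathrm{out}},\mathbf v)=1$ for all reachable states $(\ell_{\mathrm{out}},\mathbf v)$. A PLWF satisfies (C2) and (C1') $\mathrm{ewt}(h)(\ell,\mathbf v)\ge h(\ell,\mathbf v)$ for all reachable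 states with $\ell\ne\ell_{\mathrm{out}}$. *)

(* Defs.v *)
(* R : realType, valuations in R^k are
   k.-tuple R with the product (= Borel) sigma-algebra of measurable_structure. *)
From HB Require Import structures.
From mathcomp Require Import all_boot all_order all_algebra.
From mathcomp Require Import all_classical all_reals all_analysis.
From Stdlib Require Lists.List.
Set Implicit Arguments. Unset Strict Implicit. Unset Printing Implicit Defensive.
Import Order.TTheory GRing.Theory Num.Theory.
Local Open Scope classical_set_scope.
Local Open Scope ring_scope.

Section WPTS.
Context {R : realType} {n m : nat} {L : finType}.
(* n = |V_p| (program variables), m = |V_r| (sampling variables) *)

Record fork := Fork {
  f_dest : L;
  f_prob : R;
  f_upd  : n.-tuple R -> m.-tuple R -> n.-tuple R;
  f_wt   : n.-tuple R -> m.-tuple R -> R }.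

Record transition := Trans {
  t_src   : L;
  t_guard : set (n.-tuple R);
  t_forks : seq fork }.

(* Pi = (V_p, V_r, L, l_init, l_out, mu_init, D, T); the product distribution
   D is given by its independent marginals distD i (one per sampling variable);
   the finite set of transitions is given as a list. *)
Record wpts := WPTS {
  l_init  : L;
  l_out   : L;
  mu_init : probability (n.-tuple R) R;
  distD   : 'I_m -> probability R R;
  trans   : seq transition }.

Variable P : wpts.

Definition in_supp_R (mu : probability R R) (x : R) : Prop :=
  forall e : R, 0 < e ->
    (0 < mu [set y : R | (`|y - x| < e)%R])%E.
Definition in_supp_vec (mu : probability (n.-tuple R) R) (v : n.-tuple R) : Prop :=
  forall e : R, 0 < e ->
    (0 < mu [set w : n.-tuple R | forall i, (`|tnth w i - tnth v i| < e)%R])%E.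
Definition in_supp_D (r : m.-tuple R) : Prop :=
  forall i, in_supp_R (distD P i) (tnth r i).

Definition wf_fork (f : fork) : Prop :=
  [/\ 0 < f_prob f <= 1,
      measurable_fun setT (fun p : n.-tuple R * m.-tuple R => f_upd f p.1 p.2),
      measurable_fun setT (fun p : n.-tuple R * m.-tuple R => f_wt f p.1 p.2)
    & forall v r, 0 <= f_wt f v r].

Definition wf_transition (t : transition) : Prop :=
  [/\ t_src t <> l_out P,
      measurable (t_guard t),
      (0 < size (t_forks t))%N,
      \sum_(f <- t_forks t) f_prob f = 1
    & forall f, Stdlib.Lists.List.In f (t_forks t) -> wf_fork f].

Definition wf_wpts : Prop :=
  [/\ forall t, Stdlib.Lists.List.In t (trans P) -> wf_transition t,
      exists C : R, forall v, in_supp_vec (mu_init P) v -> forall i, `|tnth v i| <= C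
    & forall (l : L) (v : n.-tuple R), l <> l_out P ->
        exists! i : nat, exists t, Stdlib.Lists.List.nth_error (trans P) i = Some t /\
                                   t_src t = l /\ t_guard t v].

(* the (unique, under wf_wpts) enabled transition *)
Definition enabled (l : L) (v : n.-tuple R) : option transition :=
  Stdlib.Lists.List.find (fun t => (t_src t == l) && `[< t_guard t v >]) (trans P).

(* choice of a fork from a uniform sample u in [0,1]: fork j is chosen iff
   p_1 + ... + p_{j-1} <= u < p_1 + ... + p_j (the last fork absorbs the rest),
   hence with probability p_j *)
Fixpoint select_fork (u acc : R) (fs : seq fork) : option fork :=
  match fs with
  | [::] => None
  | [:: f] => Some f
  | f :: fs' => if u < acc + f_prob f then Some f
                else select_fork u (acc + f_prob f) fs'
  end.

Definition wstate := (L * n.-tuple R * R)%type.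

Definition step (s : wstate) (u : R) (r : m.-tuple R) : wstate :=
  let: (l, v, w) := s in
  if l == l_out P then s else
  match enabled l v with
  | None => s
  | Some t => match select_fork u 0 (t_forks t) with
              | None => s
              | Some f => (f_dest f, f_upd f v r, w * f_wt f v r)
              end
  end.

(* Driving randomness on a probability space (Omega, Pr):
   U k  = uniform sample used to choose the fork at step k,
   X k i = sample of the i-th sampling variable at step k. *)
Context {d : measure_display} {Omega : measurableType d}.
Variables (Pr : probability Omega R) (U : nat -> Omega -> R)
          (X : nat -> 'I_m -> Omega -> R).

Definition sample (k : nat) (om : Omega) : m.-tuple R := [tuple X k i om | i < m].

Definition mutually_independent (I : eqType) (Y : I -> Omega -> R) : Prop :=
  forall (J : seq I) (B : I -> set R), uniq J -> (forall j, measurable (B j)) ->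
    Pr (\bigcap_(j in [set j | j \in J]) (Y j @^-1` B j)) =
    (\prod_(j <- J) Pr (Y j @^-1` B j))%E.

Definition noise (j : nat * option 'I_m) : Omega -> R :=
  match j.2 with None => U j.1 | Some i => X j.1 i end.

Definition noise_model : Prop :=
  [/\ forall j, measurable_fun setT (noise j),
      mutually_independent noise,
      forall k (B : set R), measurable B ->
        Pr (U k @^-1` B) = lebesgue_measure (B `&` `[0%R, 1%R])
    & forall k i (B : set R), measurable B -> Pr (X k i @^-1` B) = distD P i B].

Fixpoint run (l : L) (v : n.-tuple R) (k : nat) (om : Omega) : wstate :=
  match k with
  | 0 => (l, v, 1)
  | k'.+1 => step (run l v k' om) (U k' om) (sample k' om)
  end.

Definition out_at (v : n.-tuple R) (om : Omega) : pred nat :=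
  fun k => (run (l_init P) v k om).1.1 == l_out P.

Definition final (v : n.-tuple R) (om : Omega) : option (n.-tuple R * R) :=
  match pselect (exists k, out_at v om k) with
  | left H => let s := run (l_init P) v (ex_minn H) om in Some (s.1.2, s.2)
  | right _ => None
  end.

Definition expected_weight (v : n.-tuple R) (A : set (n.-tuple R)) : \bar R :=
  \int[Pr]_om (match final v om with
               | Some (vT, wT) => if `[< A vT >] then wT%:E else 0%E
               | None => 0%E end).

Definition AST : Prop :=
  forall v, in_supp_vec (mu_init P) v ->
    Pr [set om | exists k, out_at v om k] = 1%E.

Definition score_at_end : Prop :=
  AST /\
  exists (i : nat) (t : transition) (f : fork) (M : R),
    [/\ Stdlib.Lists.List.nth_error (trans P) i = Some t /\ t_forks t = [:: f],
        f_dest f = l_out P /\ f_prob f = 1,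
        forall v r, f_upd f v r = v,
        0 < M /\ forall v r, 0 <= f_wt f v r <= M
      & forall (j : nat) (t' : transition), Stdlib.Lists.List.nth_error (trans P) j = Some t' ->
          j <> i -> forall f', Stdlib.Lists.List.In f' (t_forks t') ->
            f_dest f' <> l_out P /\ forall v r, f_wt f' v r = 1].

(* expected-weight transformer; E_{r ~ D} is taken as the expectation over
   the step-0 sample (whose law is D under noise_model) *)
Definition ewt (h : L -> n.-tuple R -> R) (l : L) (v : n.-tuple R) : \bar R :=
  if l == l_out P then 1%E else
  match enabled l v with
  | None => 0%E
  | Some t => (\sum_(f <- t_forks t)
      (f_prob f)%:E *
      \int[Pr]_om ((f_wt f v (sample 0 om) *
                     h (f_dest f) (f_upd f v (sample 0 om)))%R)%:E)%E
  end.

Inductive reachable : L -> n.-tuple R -> Prop :=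
| reach_init v : in_supp_vec (mu_init P) v -> reachable (l_init P) v
| reach_step l v t f r : reachable l v -> l <> l_out P ->
    Stdlib.Lists.List.In t (trans P) -> t_src t = l -> t_guard t v ->
    Stdlib.Lists.List.In f (t_forks t) -> in_supp_D r ->
    reachable (f_dest f) (f_upd f v r).

Definition PUWF (h : L -> n.-tuple R -> R) : Prop :=
  (forall l v, reachable l v -> l <> l_out P -> (ewt h l v <= (h l v)%:E)%E) /\
  (forall v, reachable (l_out P) v -> h (l_out P) v = 1).

Definition PLWF (h : L -> n.-tuple R -> R) : Prop :=
  (forall l v, reachable l v -> l <> l_out P -> ((h l v)%:E <= ewt h l v)%E) /\
  (forall v, reachable (l_out P) v -> h (l_out P) v = 1).

End WPTS.

(* Main.v *)
(* Let W_k = w_k * h(l_k, v_k) along the run started at (l_init, v). Before the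
    exit every score is 1, so w_k = 1 there, and by independence of the noise of
    step k from the past, E[W_(k+1)] = E[W_k on {l_k = l_out}; ewt(h)(l_k, v_k)
    elsewhere]. Almost surely all samples lie in the support of D, hence the run
    only meets reachable states and (C1) makes E[W_k] nonincreasing ((C1'):
    nondecreasing) from E[W_0] = h(l_init, v). By almost sure termination and
    (C2), W_k converges almost surely to the weight at termination, and it is
    bounded by the product of the bounds on scores and on |h|, so dominated
    convergence passes to the limit. *)
Require Import Defs.
From HB Require Import structures.
From mathcomp Require Import all_boot all_order all_algebra.
From mathcomp Require Import all_classical all_reals all_analysis.
From mathcomp Require Import measurable_realfun.
Import Order.TTheory GRing.Theory Num.Theory.
Local Open Scope classical_set_scope.
Local Open Scope ring_scope.

Set Implicit Arguments.
Unset Strict Implicit.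
Unset Printing Implicit Defensive.

(** * Integrals of bounded functions against a probability *)

Section bounded_integrals.
Context {d : measure_display} {T : measurableType d} {R : realType}.
Variables (P : probability T R) (C : R).

Lemma ebounded_integrable (f : T -> \bar R) : measurable_fun setT f ->
  (forall x, (`|f x| <= C%:E)%E) -> P.-integrable setT f.
Proof.
move=> mf fC; apply: (le_integrable _ mf _ (g := cst C%:E)) => //.
  by move=> x _ /=; rewrite (le_trans (fC x))// lee_fin ler_norm.
exact: finite_measure_integrable_cst.
Qed.

Lemma bounded_integrable (f : T -> R) :
  measurable_fun setT f -> (forall x, `|f x| <= C) ->
  P.-integrable setT (EFin \o f).
Proof.
move=> mf fC; apply: ebounded_integrable => [|x]; first exact/measurable_EFinP.
by rewrite /= lee_fin.
Qed.

Lemma abse_integral_le (f : T -> R) :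
  measurable_fun setT f -> (forall x, `|f x| <= C) ->
  (`|\int[P]_x (f x)%:E| <= C%:E)%E.
Proof.
move=> mf fC; have mfE := (measurable_EFinP _ _).2 mf.
apply: le_trans (le_abse_integral _ _ _) _ => //.
rewrite -[leRHS]mule1 -(probability_setT P) -integral_cst//.
apply: ge0_le_integral => //; first exact: measurableT_comp.
by move=> z _; rewrite lee_fin.
Qed.

End bounded_integrals.

(** * Independence, product laws and generated sigma-algebras *)

Section independence.
Context {d : measure_display} {Omega : measurableType d} {R : realType}.
Variable Pr : probability Omega R.

(* The independence of [Y] and [Z] identifies the law of [(Y, Z)] with the
   product of their laws. *)
Lemma integral_indep d1 d2 (T1 : measurableType d1) (T2 : measurableType d2)
    (Y : Omega -> T1) (Z : Omega -> T2) (g : T1 * T2 -> R) (C : R) :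
  measurable_fun setT Y -> measurable_fun setT Z ->
  (forall A B, measurable A -> measurable B ->
    Pr (Y @^-1` A `&` Z @^-1` B) = (Pr (Y @^-1` A) * Pr (Z @^-1` B))%E) ->
  measurable_fun setT g -> (forall x, `|g x| <= C) ->
  (\int[Pr]_om (g (Y om, Z om))%:E =
     \int[Pr]_om \int[Pr]_om' (g (Y om, Z om'))%:E)%E /\
  measurable_fun setT
    ((fun om => \int[Pr]_om' (g (Y om, Z om'))%:E)%E : Omega -> \bar R).
Proof.
move=> mY mZ YZ mg gC.
have mYZ : measurable_fun setT (fun om => (Y om, Z om)).
  exact/measurable_fun_pairP.
pose Y' : {mfun Omega >-> T1} := HB.pack Y (isMeasurableFun.Build _ _ _ _ Y mY).
pose Z' : {mfun Omega >-> T2} := HB.pack Z (isMeasurableFun.Build _ _ _ _ Z mZ).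
pose V' : {mfun Omega >-> (T1 * T2)%type} :=
  HB.pack (fun om => (Y om, Z om)) (isMeasurableFun.Build _ _ _ _ _ mYZ).
pose PY := distribution Pr Y'; pose PZ := distribution Pr Z'.
pose PV := distribution Pr V'.
(* A measure on the product is determined by its values on rectangles, and there [YZ] gives the
   product formula. *)
have lawE A : measurable A -> (PY \x PZ)%E A = PV A.
  by move=> mA; apply: product_measure_unique => // B1 B2 mB1 mB2; exact: YZ.
have gE x : (\int[Pr]_om' (g (x, Z om'))%:E = \int[PZ]_z (g (x, z))%:E)%E.
  rewrite (integral_pushforward mZ (D := setT) (f := fun z => (g (x, z))%:E))//.
    by apply/measurable_EFinP; exact: measurableT_comp.
  rewrite preimage_setT.
  apply: (@bounded_integrable _ _ _ _ C (fun om => g (x, Z om))) => //.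
  apply: measurableT_comp => //; exact: measurable_fun_pair.
have mgE : measurable_fun setT (EFin \o g) by exact/measurable_EFinP.
have igV : (PY \x PZ)%E.-integrable setT (EFin \o g).
  exact: (bounded_integrable [the probability _ _ of (PY \x PZ)%E] mg gC).
have mF : measurable_fun setT (fun x => (\int[PZ]_z (g (x, z))%:E)%E).
  exact: (measurable_fubini_F igV).
split; last first.
  apply: (eq_measurable_fun ((fun x => (\int[PZ]_z (g (x, z))%:E)%E) \o Y)).
    by move=> om _; rewrite /= gE.
  exact: measurableT_comp.
under [RHS]eq_integral do rewrite gE.
transitivity (\int[PV]_x (g x)%:E)%E.
  rewrite (integral_pushforward mYZ (D := setT))// preimage_setT.
  apply: (@bounded_integrable _ _ _ _ C
    (g \o (fun om => (Y om, Z om)))) => [|om].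
    exact: measurableT_comp.
  exact: gC.
have iF : Pr.-integrable setT ((fun x => (\int[PZ]_z (g (x, z))%:E)%E) \o Y).
  apply: ebounded_integrable (measurableT_comp mF mY) _ => om.
  by apply: abse_integral_le => //; exact: measurableT_comp.
transitivity (\int[PY]_x \int[PZ]_z (g (x, z))%:E)%E.
  rewrite (integral12_prod_meas1 igV).
  by apply: eq_measure_integral => A mA _; exact/esym/lawE.
by rewrite (integral_pushforward mY (D := setT)) ?preimage_setT.
Qed.

End independence.

(** Both sides, as functions of [A], are finite measures. They agree on the pi-system [G], hence on
    the sigma-algebra it generates. *)
Lemma indep_g_sigma d (Omega : measurableType d) (R : realType)
    (Pr : probability Omega R) (G : set (set Omega)) (B : set Omega) :
  G `<=` measurable -> setI_closed G -> G setT -> measurable B ->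
  (forall A, G A -> Pr (A `&` B) = (Pr A * Pr B)%E) ->
  forall A, <<s G >> A -> Pr (A `&` B) = (Pr A * Pr B)%E.
Proof.
move=> Gm GI GT mB GB A sA.
have k0 : 0 <= fine (Pr B) by exact: fine_ge0.
transitivity (mscale (NngNum k0) Pr A).
  apply: (g_sigma_algebra_measure_unique G Gm (fun=> setT) _ _
    (mrestr Pr mB) (mscale (NngNum k0) Pr)) => //.
  - by rewrite bigcup_const//; exists 0%N.
  - move=> X GX; rewrite /= /mscale /= /mrestr fineK ?fin_num_measure//.
    by rewrite GB// muleC.
  - move=> k; rewrite /= /mrestr setTI.
    by rewrite (le_lt_trans (probability_le1 _ _))// ltry.
by rewrite /= /mscale /= fineK ?fin_num_measure// muleC.
Qed.

(** * Events depending on finitely many noise variables *)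

Section cylinders.
Context {d : measure_display} {Omega : measurableType d} {R : realType}.
Context {I : eqType}.
Variables (Pr : probability Omega R) (Y : I -> Omega -> R).

(** A pi-system generating the sigma-algebra of the variables indexed by [J]. It allows [Omega] to
    be viewed as a coarser measurable space that sees only these variables. *)
Definition cylinders (J : seq I) : set (set Omega) :=
  [set A | exists2 B : I -> set R, (forall j, measurable (B j)) &
     A = \bigcap_(j in [set j | j \in J]) (Y j @^-1` B j)].

Lemma cylinders_setT J : cylinders J setT.
Proof.
exists (fun=> setT); first by move=> j.
by apply/esym; rewrite -subTset => x _ j _.
Qed.

Lemma cylinders_setI J : setI_closed (cylinders J).
Proof.
move=> _ _ [B1 mB1 ->] [B2 mB2 ->].
exists (fun j => B1 j `&` B2 j); first by move=> j; exact: measurableI.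
by rewrite -bigcapI.
Qed.

Lemma measurable_noise_cylinders J j : j \in J ->
  measurable_fun setT (Y j : g_sigma_algebraType (cylinders J) -> R).
Proof.
move=> jJ _ B mB; rewrite setTI; apply: sub_sigma_algebra.
(* Only coordinate [j] is constrained. *)
exists (fun i => if i == j then B else setT).
  by move=> i; case: ifP.
apply/seteqP; split => [x Bx i _|x /(_ j jJ)] /=; last by rewrite eqxx.
by case: eqP => [->|].
Qed.

Hypothesis mY : forall j, measurable_fun setT (Y j).

Lemma sub_cylinders J : <<s cylinders J >> `<=` measurable.
Proof.
apply: smallest_sub; first exact: sigma_algebra_measurable.
move=> _ [B mB ->].
apply: fin_bigcap_measurable => [|j _]; first exact: finite_seq.
by rewrite -[X in measurable X]setTI; exact: mY.
Qed.

Hypothesis indY : mutually_independent Pr Y.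

(** [indep_g_sigma] is applied once in each argument, which reduces the claim to two cylinders;
    there it is mutual independence over [J1 ++ J2]. *)
Lemma indep_cylinders J1 J2 A1 A2 : uniq (J1 ++ J2) ->
  <<s cylinders J1 >> A1 -> <<s cylinders J2 >> A2 ->
  Pr (A1 `&` A2) = (Pr A1 * Pr A2)%E.
Proof.
move=> uJ sA1 sA2.
have cylm J : cylinders J `<=` measurable.
  by move=> A cA; apply: (@sub_cylinders J); exact: sub_sigma_algebra.
have [uJ1 dJ uJ2] : [/\ uniq J1, ~~ has [in J1] J2 & uniq J2].
  by apply/and3P; rewrite -cat_uniq.
apply: (indep_g_sigma (@cylm J1)) sA1 => //.
- exact: cylinders_setI.
- exact: cylinders_setT.
- exact: sub_cylinders sA2.
move=> {}A1 cA1; rewrite setIC muleC.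
apply: (indep_g_sigma (@cylm J2)) sA2 => //.
- exact: cylinders_setI.
- exact: cylinders_setT.
- exact: cylm cA1.
move=> {}A2 [B2 mB2 ->]; case: cA1 => B1 mB1 ->.
(* As [J1] and [J2] are disjoint, the two families of conditions glue into one. *)
pose B j := if j \in J1 then B1 j else B2 j.
have mB j : measurable (B j) by rewrite /B; case: ifP.
have B1E j : j \in J1 -> B j = B1 j by rewrite /B => ->.
have B2E j : j \in J2 -> B j = B2 j.
  by rewrite /B; case: ifP => // jJ1 jJ2; case/hasP: dJ; exists j.
have -> : \bigcap_(j in [set j | j \in J2]) (Y j @^-1` B2 j) =
          \bigcap_(j in [set j | j \in J2]) (Y j @^-1` B j).
  by apply: eq_bigcapr => j /B2E ->.
have -> : \bigcap_(j in [set j | j \in J1]) (Y j @^-1` B1 j) =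
          \bigcap_(j in [set j | j \in J1]) (Y j @^-1` B j).
  by apply: eq_bigcapr => j /B1E ->.
rewrite (indY uJ2 mB) (indY uJ1 mB) muleC -big_cat -(indY uJ mB) setIC.
congr (Pr _); apply/seteqP; split => [x [H1 H2] j /=|x H].
  by rewrite mem_cat => /orP[/H1|/H2].
by split => j /= jJ; apply: H; rewrite /= mem_cat jJ ?orbT.
Qed.

End cylinders.

(** * Measurability of one step and of the whole run *)

Section step_measurability.
Context {R : realType} {n m : nat} {L : finType}.
Variable Pi : @wpts R n m L.
Hypothesis wfPi : wf_wpts Pi.

Definition weighted (h : L -> n.-tuple R -> R) (s : @wstate R n L) : R :=
  s.2 * h s.1.1 s.1.2.

Section measurable_state.
Context {d : measure_display} {T : measurableType d}.

(** Locations form a finite type without a sigma-algebra, so their measurability is stated through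
    the tests against each location. *)
Definition measurable_state (s : T -> @wstate R n L) :=
  [/\ forall l, measurable_fun setT (fun x => (s x).1.1 == l),
      measurable_fun setT (fun x => (s x).1.2)
    & measurable_fun setT (fun x => (s x).2)].

Lemma measurable_state_if (b : T -> bool) (s1 s2 : T -> @wstate R n L) :
  measurable_fun setT b -> measurable_state s1 -> measurable_state s2 ->
  measurable_state (fun x => if b x then s1 x else s2 x).
Proof.
move=> mb [l1 v1 w1] [l2 v2 w2]; split => [l||].
- under eq_fun do rewrite (fun_if fst) (fun_if fst) (fun_if (eq_op^~ l)).
  exact: measurable_fun_ifT.
- under eq_fun do rewrite (fun_if fst) (fun_if snd).
  exact: measurable_fun_ifT.
- under eq_fun do rewrite (fun_if snd).
  exact: measurable_fun_ifT.
Qed.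

Lemma measurable_weighted (h : L -> n.-tuple R -> R) (s : T -> @wstate R n L) :
  (forall l, measurable_fun setT (h l)) -> measurable_state s ->
  measurable_fun setT (fun x => weighted h (s x)).
Proof.
move=> mh [ml mv mw]; apply: measurable_funM => //.
(* Only the [h l] are measurable, so the location is fixed by splitting into a finite sum over all
   locations. *)
have -> : (fun x => h (s x).1.1 (s x).1.2) =
    (fun x => \sum_(l : L) if (s x).1.1 == l then h l (s x).1.2 else 0).
  apply/funext => x; rewrite (bigD1 (s x).1.1)//= eqxx big1 ?addr0// => l.
  by rewrite eq_sym => /negbTE ->.
apply: measurable_sum => l; apply: measurable_fun_ifT => //.
exact: measurableT_comp.
Qed.

(** [step] unfolds into finitely many nested tests, on guards and then on fork thresholds.
    Inductions over the two lists ([mselect], [mfind]) reduce it to [measurable_state_if]. *)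
Lemma measurable_state_step (s : T -> @wstate R n L) (u : T -> R)
    (r : T -> m.-tuple R) :
  measurable_state s -> measurable_fun setT u -> measurable_fun setT r ->
  measurable_state (fun x => step Pi (s x) (u x) (r x)).
Proof.
move=> ms mu mr; have [ml mv mw] := ms.
pose move_to (f : @fork R n m L) (x : T) : @wstate R n L :=
  (f_dest f, f_upd f (s x).1.2 (r x), (s x).2 * f_wt f (s x).1.2 (r x)).
have mvr : measurable_fun setT (fun x => ((s x).1.2, r x)).
  exact: measurable_fun_pair.
have mmove f : wf_fork f -> measurable_state (move_to f).
  move=> [_ mupd mwt _]; split => //=.
    exact: (measurableT_comp mupd mvr).
  apply: measurable_funM => //; exact: (measurableT_comp mwt mvr).
have mselect acc fs : (forall f, List.In f fs -> wf_fork f) ->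
    measurable_state (fun x =>
      if select_fork (u x) acc fs is Some f then move_to f x else s x).
  elim: fs acc => [|f [|f' fs] IH] acc wf //=.
    by apply: mmove; apply: wf; left.
  rewrite -/(select_fork _ _ (f' :: fs)).
  have -> : (fun x => if (if u x < acc + f_prob f then Some f
        else select_fork (u x) (acc + f_prob f) (f' :: fs)) is Some g
        then move_to g x else s x) = (fun x => if u x < acc + f_prob f
        then move_to f x
        else if select_fork (u x) (acc + f_prob f) (f' :: fs) is Some g
        then move_to g x else s x).
    by apply/funext => x; case: ifP.
  apply: measurable_state_if.
  - exact: measurable_fun_ltr.
  - by apply: mmove; apply: wf; left.
  - by apply: IH => g gfs; apply: wf; right.
have mfind ts : (forall t, List.In t ts -> wf_transition Pi t) ->
    measurable_state (fun x => if List.find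
        (fun t => (t_src t == (s x).1.1) && `[< t_guard t (s x).1.2 >]) ts
      is Some t then
        if select_fork (u x) 0 (t_forks t) is Some f then move_to f x else s x
      else s x).
  elim: ts => [|t ts IH] wf //=.
  have [_ mg _ _ wff] := wf t (or_introl erefl).
  rewrite (_ : (fun x => _) = fun x =>
     if (t_src t == (s x).1.1) && `[< t_guard t (s x).1.2 >] then
       if select_fork (u x) 0 (t_forks t) is Some f then move_to f x else s x
     else if List.find
        (fun t => (t_src t == (s x).1.1) && `[< t_guard t (s x).1.2 >]) ts
      is Some t then
        if select_fork (u x) 0 (t_forks t) is Some f then move_to f x else s x
      else s x); last by apply/funext => x; case: ifP.
  apply: measurable_state_if.
  - apply: measurable_and.
      by under eq_fun do rewrite eq_sym; exact: ml.
    apply: (measurable_fun_bool true); rewrite setTI.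
    rewrite [X in measurable X](_ : _ = (fun x => (s x).1.2) @^-1` t_guard t).
      by rewrite -[X in measurable X]setTI; exact: mv.
    by apply/seteqP; split => x /=; [move/asboolP|move=> ?; exact/asboolP].
  - exact: mselect.
  - by apply: IH => t' t'ts; apply: wf; right.
have [wft _ _] := wfPi.
rewrite (_ : (fun x => _) = fun x => if (s x).1.1 == l_out Pi then s x else
  if enabled Pi (s x).1.1 (s x).1.2 is Some t then
        if select_fork (u x) 0 (t_forks t) is Some f then move_to f x else s x
      else s x); last first.
  by apply/funext => x; rewrite /move_to /step; case: (s x) => -[].
apply: measurable_state_if => //; exact: mfind.
Qed.

End measurable_state.

(* The history may be equipped with any sigma-algebra that makes the noise of
   the first [k] steps measurable. *)
Lemma measurable_state_run {d : measure_display} {T : measurableType d}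
    (U : nat -> T -> R) (X : nat -> 'I_m -> T -> R) l v k :
  (forall j, (j.1 < k)%N -> measurable_fun setT (noise U X j)) ->
  measurable_state (run Pi U X l v k).
Proof.
elim: k => [|k IH] mN; first by split => [l'||] /=; exact: measurable_cst.
apply: measurable_state_step.
- by apply: IH => j jk; apply: mN; exact: ltnW.
- exact: (mN (k, None)).
- apply/measurable_fun_tnthP => i.
  apply: (eq_measurable_fun (X k i)); last exact: (mN (k, Some i)).
  by move=> x _; rewrite /= tnth_mktuple.
Qed.

End step_measurability.

(** * Laws on tuples are determined by measurable rectangles *)

Definition tuple_cylinders (R : realType) (m : nat) : set (set (m.-tuple R)) :=
  cylinders (fun i (r : m.-tuple R) => tnth r i) (enum 'I_m).

Lemma tuple_law_unique (R : realType) (m : nat)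
    (P1 P2 : probability (m.-tuple R) R) :
  (forall A, tuple_cylinders A -> P1 A = P2 A) ->
  forall A, measurable A -> P1 A = P2 A.
Proof.
move=> P12; apply: (measure_unique (@tuple_cylinders R m) (fun=> setT)) => //.
- apply/seteqP; split => A mA; last first.
    by apply: sub_cylinders mA => i; exact: measurable_tnth.
  (* The coordinates are measurable for the sigma-algebra generated by rectangles, hence so is the
     identity; this puts every measurable set in it. *)
  have /measurable_fun_tnthP mid i := measurable_noise_cylinders
    (Y := fun i (r : m.-tuple R) => tnth r i) (mem_enum 'I_m i).
  by have := mid measurableT A mA; rewrite setTI; exact.
- exact: cylinders_setI.
- by move=> _; exact: cylinders_setT.
- by rewrite bigcup_const//; exists 0%N.
- by move=> k; rewrite (le_lt_trans (probability_le1 _ _))// ltry.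
Qed.

(** * The law of the noise and the random choice of a fork *)

Section noise.
Context {R : realType} {n m : nat} {L : finType} {Pi : @wpts R n m L}.
Context {d : measure_display} {Omega : measurableType d}.
Context {Pr : probability Omega R} {U : nat -> Omega -> R}.
Context {X : nat -> 'I_m -> Omega -> R}.
Hypothesis noiseP : noise_model Pi Pr U X.

Let mN j : measurable_fun setT (noise U X j).
Proof. by case: noiseP. Qed.

Lemma measurable_sample k : measurable_fun setT (sample X k).
Proof.
apply/measurable_fun_tnthP => i.
apply: (eq_measurable_fun (X k i)); last exact: (mN (k, Some i)).
by move=> x _; rewrite /= tnth_mktuple.
Qed.

(** The value does not depend on [k], so the samples of all steps share one law. *)
Lemma sample_cylinder k (B : 'I_m -> set R) : (forall i, measurable (B i)) ->
  Pr (sample X k @^-1`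
    \bigcap_(i in [set i | i \in enum 'I_m]) ((fun r => tnth r i) @^-1` B i)) =
  (\prod_(i <- enum 'I_m) distD Pi i (B i))%E.
Proof.
move=> mB; have [_ indN _ lawX] := noiseP.
pose J := [seq (k, Some i) | i <- enum 'I_m].
(* The default [setT] concerns only fork coordinates, which [J] leaves out. *)
pose B' (j : nat * option 'I_m) := if j.2 is Some i then B i else setT.
have uJ : uniq J by rewrite map_inj_uniq ?enum_uniq// => i j [].
have mB' j : measurable (B' j) by rewrite /B'; case: j.2.
have := indN J B' uJ mB'; rewrite big_map.
under eq_bigr do rewrite lawX//.
move=> <-; congr (Pr _); apply/seteqP.
split => [om H j /= /mapP[i ie ->]|om H i /= ie].
  by have := H i ie; rewrite /= tnth_mktuple.
by rewrite tnth_mktuple; apply: (H (k, Some i)); apply/mapP; exists i.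
Qed.

(** Links the sample consumed at step [k] of the run to the step-0 sample through which [ewt] is
    defined. *)
Lemma integral_sample k (phi : m.-tuple R -> R) (C : R) :
  measurable_fun setT phi -> (forall r, `|phi r| <= C) ->
  (\int[Pr]_om (phi (sample X k om))%:E =
   \int[Pr]_om (phi (sample X 0 om))%:E)%E.
Proof.
move=> mphi phiC.
pose S j : {mfun Omega >-> m.-tuple R} :=
  HB.pack (sample X j) (isMeasurableFun.Build _ _ _ _ _ (measurable_sample j)).
have law j : (\int[Pr]_om (phi (sample X j om))%:E =
    \int[distribution Pr (S j)]_r (phi r)%:E)%E.
  rewrite (integral_pushforward (measurable_sample j) (D := setT)
    (f := fun r => (phi r)%:E))//.
    exact/measurable_EFinP.
  rewrite preimage_setT.
  apply: (@bounded_integrable _ _ _ _ C (phi \o sample X j)) => [|om].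
    exact: measurableT_comp (measurable_sample j).
  exact: phiC.
rewrite !law; apply: eq_measure_integral => A mA _.
apply: tuple_law_unique mA => _ [B mB ->].
by rewrite /= /distribution /pushforward !sample_cylinder.
Qed.

(** [integral_indep] for the identity of [Omega], seen as two variables with values in two coarser
    spaces. They are independent because they depend on disjoint sets of noise variables. *)
Lemma integral_indep_noise (J1 J2 : seq (nat * option 'I_m))
    (g : g_sigma_algebraType (cylinders (noise U X) J1) *
         g_sigma_algebraType (cylinders (noise U X) J2) -> R) (C : R) :
  uniq (J1 ++ J2) -> measurable_fun setT g -> (forall x, `|g x| <= C) ->
  (\int[Pr]_om (g (om, om))%:E =
     \int[Pr]_om \int[Pr]_om' (g (om, om'))%:E)%E /\
  measurable_fun setT
    ((fun om => \int[Pr]_om' (g (om, om'))%:E)%E : Omega -> \bar R).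
Proof.
move=> uJ mg gC; have [_ indN _ _] := noiseP.
have mid J : measurable_fun setT
    ((fun om => om) : Omega -> g_sigma_algebraType (cylinders (noise U X) J)).
  by move=> _ A mA; rewrite setTI; apply: sub_cylinders mA.
apply: (integral_indep (mid J1) (mid J2) _ mg gC) => A B mA mB.
exact: (indep_cylinders mN indN uJ).
Qed.

(** Within one step, the fork choice and the sample use disjoint noise variables, so the expectation
    factors. *)
Lemma integral_indep_fork k (I : set R) (phi : m.-tuple R -> R) (C : R) :
  measurable I -> measurable_fun setT phi -> (forall r, `|phi r| <= C) ->
  (\int[Pr]_om (\1_I (U k om) * phi (sample X k om))%:E =
   lebesgue_measure (I `&` `[0%R, 1%R]) *
     \int[Pr]_om (phi (sample X 0 om))%:E)%E.
Proof.
move=> mI mphi phiC; have [_ _ lawU _] := noiseP.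
rewrite -(integral_sample k mphi phiC) -(lawU k)//.
pose J1 : seq (nat * option 'I_m) := [:: (k, None)].
pose J2 : seq (nat * option 'I_m) := [seq (k, Some i) | i <- enum 'I_m].
have uJ : uniq (J1 ++ J2).
  rewrite /= map_inj_uniq ?enum_uniq ?andbT; last by move=> i j [].
  by apply/negP => /mapP[].
have mU : measurable_fun setT
    (U k : g_sigma_algebraType (cylinders (noise U X) J1) -> R).
  exact: (measurable_noise_cylinders (Y := noise U X)
    (mem_head (k, None) [::])).
have mS : measurable_fun setT
    (sample X k : g_sigma_algebraType (cylinders (noise U X) J2) -> m.-tuple R).
  apply/measurable_fun_tnthP => i.
  apply: (@eq_measurable_fun _ _
    (g_sigma_algebraType (cylinders (noise U X) J2)) R setT (X k i)).
    by move=> x _; rewrite /= tnth_mktuple.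
  have iJ2 : (k, Some i) \in J2 by apply/mapP; exists i; rewrite ?mem_enum.
  exact: (measurable_noise_cylinders (Y := noise U X) iJ2).
have C0 : 0 <= C by exact: (le_trans (normr_ge0 _) (phiC [tuple 0 | _ < m])).
have [|x|-> _] := integral_indep_noise (J1 := J1) (J2 := J2)
  (g := fun x => \1_I (U k x.1) * phi (sample X k x.2)) (C := C) uJ.
- apply: measurable_funM.
    apply: measurableT_comp; first exact: measurable_indic.
    exact: (measurableT_comp mU measurable_fst).
  apply: measurableT_comp => //.
  exact: (measurableT_comp mS measurable_snd).
- rewrite normrM -[leRHS]mul1r ler_pM//.
  by rewrite indicE; case: (_ \in _); rewrite ?normr1 ?normr0.
have mphiS : measurable_fun setT (fun om => phi (sample X k om)).
  exact: measurableT_comp (measurable_sample k).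
have iphi : Pr.-integrable setT (EFin \o (fun om => phi (sample X k om))).
  by apply: bounded_integrable mphiS _ => om; exact: phiC.
have fphi := integrable_fin_num measurableT iphi.
transitivity (\int[Pr]_om ((\1_(U k @^-1` I) om)%:E *
    \int[Pr]_om' (phi (sample X k om'))%:E))%E.
  apply: eq_integral => om _.
  by rewrite -(integralZl measurableT iphi).
have mUI : measurable (U k @^-1` I).
  by rewrite -[X in measurable X]setTI; exact: (mN (k, None)).
rewrite -(fineK fphi) integralZr//.
  by rewrite integral_indic// setIT.
exact: integrable_indic.
Qed.

(* The case [acc = 0] is the law of a uniformly selected fork; the indicator
   [acc <= U k] makes the statement inductive. *)
Lemma integral_select_fork k (phi : @fork R n m L -> m.-tuple R -> R) (C : R)
    (fs : seq fork) (acc : R) :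
  (forall f, List.In f fs -> [/\ 0 <= f_prob f, measurable_fun setT (phi f)
     & forall r, `|phi f r| <= C]) ->
  (0 < size fs)%N -> 0 <= acc -> \sum_(f <- fs) f_prob f = 1 - acc ->
  let g om := if acc <= U k om then
      if select_fork (U k om) acc fs is Some f then phi f (sample X k om) else 0
    else 0 in
  Pr.-integrable setT (EFin \o g) /\
  (\int[Pr]_om (g om)%:E = \sum_(f <- fs)
    (f_prob f)%:E * \int[Pr]_om (phi f (sample X 0 om))%:E)%E.
Proof.
have integrable_piece f I : measurable I -> measurable_fun setT (phi f) ->
    (forall r, `|phi f r| <= C) ->
    Pr.-integrable setT
      (EFin \o (fun om => \1_I (U k om) * phi f (sample X k om))).
  move=> mI mphi phiC; apply: (@bounded_integrable _ _ _ _ C _) => [|om].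
    apply: measurable_funM.
      exact: measurableT_comp (measurable_indic _) (mN (k, None)).
    exact: measurableT_comp (measurable_sample k).
  rewrite normrM -[leRHS]mul1r ler_pM//.
  by rewrite indicE; case: (_ \in _); rewrite ?normr1 ?normr0.
elim: fs acc => [//|f [|f' fs] IH] acc wf _ acc0.
  rewrite !big_seq1 => sum1 /=.
  have [p0 mphi phiC] := wf f (or_introl erefl).
  (* The last fork takes every value from [acc] on; the law of [U k] cuts this half-line down to
     [[acc, 1]], of length [f_prob f]. *)
  pose I := `[acc, +oo[%classic : set R.
  have gE om : (if acc <= U k om then phi f (sample X k om) else 0) =
      \1_I (U k om) * phi f (sample X k om).
    rewrite indicE /I; case: ifPn => H.
      by rewrite mem_set ?mul1r//= in_itv/= H.
    by rewrite memNset ?mul0r//= in_itv/= andbT; apply/negP.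
  split.
    apply: (eq_integrable measurableT (EFin \o
        (fun om => \1_I (U k om) * phi f (sample X k om)))) => [om _|].
      by rewrite /= gE.
    exact: (integrable_piece f I (measurable_itv _) mphi phiC).
  under eq_integral do rewrite gE.
  rewrite (integral_indep_fork k (measurable_itv _ : measurable I) mphi phiC).
  congr (_ * _)%E.
  rewrite (_ : I `&` _ = `[acc, 1]%classic).
    rewrite lebesgue_measure_itv/= lte_fin; case: ltP => acc1.
      by rewrite sum1 EFinB.
    by congr EFin; apply/eqP; rewrite eq_le p0 sum1 subr_le0.
  apply/seteqP; rewrite /I; split => x /=; rewrite !in_itv/= andbT.
    by move=> [-> /andP[]].
  by move=> /andP[ax ->]; rewrite ax (le_trans acc0 ax).
move=> sum1.
have [p0 mphi phiC] := wf f (or_introl erefl).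
have wf' g : List.In g (f' :: fs) -> [/\ 0 <= f_prob g,
    measurable_fun setT (phi g) & forall r, `|phi g r| <= C].
  by move=> gfs; apply: wf; right.
have sum' : \sum_(g <- f' :: fs) f_prob g = 1 - (acc + f_prob f).
  by rewrite opprD addrA -sum1 [in RHS]big_cons addrAC subrr add0r.
have [ig' intg'] := IH (acc + f_prob f) wf' isT (addr_ge0 acc0 p0) sum'.
(* On [acc <= U k], the head fork is chosen exactly when [U k] lies in [I]; the rest is the
   integrand [g'] of the induction hypothesis, which vanishes on [I]. *)
pose I := `[acc, acc + f_prob f[%classic : set R.
set g' := (X in EFin \o X) in ig' intg'.
have gE om : (if acc <= U k om then
      if select_fork (U k om) acc [:: f, f' & fs] is Some g
      then phi g (sample X k om) else 0 else 0) =
    \1_I (U k om) * phi f (sample X k om) + g' om.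
  rewrite indicE /I /g'.
  have [aU|Ua] := leP acc (U k om); last first.
    rewrite memNset ?mul0r ?add0r; last by rewrite /= in_itv/= leNgt Ua.
    by rewrite ifN// -ltNge (lt_le_trans Ua)// lerDl.
  rewrite /= -/(select_fork _ _ (f' :: fs)).
  have [Ua'|Ua'] := ltP (U k om) (acc + f_prob f).
    by rewrite mem_set ?mul1r ?addr0//= in_itv/= aU.
  by rewrite memNset ?mul0r ?add0r// /= in_itv/= (ltNge (U k om)) Ua' andbF.
have ip := integrable_piece f I (measurable_itv _) mphi phiC.
split.
  apply: eq_integrable (integrableD measurableT ip ig') => // om _.
  by rewrite /= gE.
under eq_integral do rewrite gE EFinD.
rewrite (integralD measurableT ip ig') intg' [in RHS]big_cons; congr (_ + _)%E.
rewrite (integral_indep_fork k (measurable_itv _ : measurable I) mphi phiC).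
congr (_ * _)%E.
(* The remaining probabilities are nonnegative with sum [1 - (acc + f_prob f)], so [I] stays inside
   the unit interval and keeps its full length. *)
have le1 : acc + f_prob f <= 1.
  rewrite -subr_ge0 -sum'; elim: (f' :: fs) wf' => [|g gs IHg] wfg.
    by rewrite big_nil.
  rewrite big_cons addr_ge0//; first by have [] := wfg g (or_introl erefl).
  by apply: IHg => g0 g0s; apply: wfg; right.
rewrite (_ : I `&` _ = I).
  rewrite lebesgue_measure_itv/= lte_fin ltrDl; case: ltP => pf.
    by rewrite -EFinB addrC addKr.
  by congr EFin; apply/eqP; rewrite eq_le p0 pf.
apply/seteqP; rewrite /I; split => x /=; first by case.
rewrite !in_itv/= => /andP[ax xa]; split; first by rewrite ax.
by rewrite (le_trans acc0 ax) (ltW (lt_le_trans xa le1)).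
Qed.

End noise.

(** * Almost-everywhere comparison and supports *)

Lemma ae_le_integral d (T : measurableType d) (R : realType)
    (mu : {measure set T -> \bar R}) (f g : T -> \bar R) :
  mu.-integrable setT f -> mu.-integrable setT g ->
  {ae mu, forall x, (f x <= g x)%E} ->
  (\int[mu]_x f x <= \int[mu]_x g x)%E.
Proof.
move=> mf mg [N [mN muN subN]].
rewrite (negligible_integral mN measurableT mf muN).
rewrite (negligible_integral mN measurableT mg muN).
have mD : measurable (setT `\` N) by exact: measurableD.
apply: le_integral => //.
- exact: (integrableS measurableT mD).
- exact: (integrableS measurableT mD).
move=> x /set_mem[_ Nx]; apply: contrapT => fg; apply: Nx; exact: subN.
Qed.

(* The complement of the support is covered by the countably many null
   intervals with rational end points. *)
Lemma ae_in_supp (R : realType) (mu : probability R R) :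
  {ae mu, forall x, in_supp_R mu x}.
Proof.
pose itv (p : rat * rat) : set R := `]ratr p.1, ratr p.2[%classic.
(* Pairs of rationals are enumerated by their codes; an interval of positive measure is replaced by
   the empty set. *)
pose F i := if unpickle i is Some p then
    if mu (itv p) == 0%E then itv p else set0
  else set0.
apply: (@negligibleS _ _ _ mu (\bigcup_i F i)); last first.
  apply: negligible_bigcup => i; rewrite /F.
  case: unpickle => [p|]; last exact: negligible_set0.
  case: eqP => [p0|_]; last exact: negligible_set0.
  by apply/negligibleP => //; exact: measurable_itv.
move=> x /= /existsNP[e /not_implyP[e0 /negP]].
rewrite -leNgt => mu0.
(* The null ball of radius [e] around [x] contains an interval with rational end points that still
   contains [x]. *)
have [a] : exists a, ratr a \in `]x - e, x[.
  by apply: rat_in_itvoo; rewrite ltrBlDr ltrDl.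
have [b] : exists b, ratr b \in `]x, (x + e)[.
  by apply: rat_in_itvoo; rewrite ltrDl.
rewrite !in_itv/= => /andP[xb be] /andP[ea ax].
have itv0 : mu (itv (a, b)) = 0%E.
  have ballE : [set y : R | `|y - x| < e] = `]x - e, x + e[%classic.
    by apply/seteqP; split => y /=; rewrite in_itv/= ltr_distl.
  apply: (subset_measure0 (B := [set y : R | `|y - x| < e])).
  - exact: measurable_itv.
  - by rewrite ballE; exact: measurable_itv.
  - move=> y /=; rewrite /itv /= in_itv/= ltr_distl => /andP[ay yb].
    by rewrite (lt_trans ea ay) (lt_trans yb be).
  - by apply/eqP; rewrite eq_le mu0 measure_ge0.
exists (pickle (a, b)); first exact: Logic.I.
by rewrite /F pickleK itv0 eqxx /itv /= in_itv/= ax xb.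
Qed.

(** * Pathwise properties of the run, and the expectation of one step *)

Section steps.
Context {R : realType} {n m : nat} {L : finType}.
Variable Pi : @wpts R n m L.
Hypothesis wfPi : wf_wpts Pi.

Lemma enabled_some l v : l <> l_out Pi -> exists t,
  [/\ enabled Pi l v = Some t, List.In t (trans Pi), t_src t = l & t_guard t v].
Proof.
move=> lout; have [_ _ tot] := wfPi.
have [i [[t [ti [tl tv]]] _]] := tot l v lout.
rewrite /enabled; case E : List.find => [t'|].
  have [t'in /andP[/eqP t'l /asboolP t'v]] := List.find_some _ _ E.
  by exists t'.
have := List.find_none _ _ E t (List.nth_error_In _ _ ti).
by rewrite tl eqxx/= => /asboolP.
Qed.

Lemma select_fork_some (u acc : R) (fs : seq (@fork R n m L)) :
  (0 < size fs)%N -> exists2 f, select_fork u acc fs = Some f & List.In f fs.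
Proof.
elim: fs acc => [//|f [|f' fs] IH] acc _; first by exists f; [|left].
rewrite /= -/(select_fork _ _ (f' :: fs)).
case: ifP => _; first by exists f; [|left].
by have [//|g gE gin] := IH (acc + f_prob f); exists g; [|right].
Qed.

Lemma step_move (s : @wstate R n L) (u : R) (r : m.-tuple R) :
  s.1.1 <> l_out Pi -> exists t f,
  [/\ List.In t (trans Pi), t_src t = s.1.1 /\ t_guard t s.1.2,
      List.In f (t_forks t)
    & step Pi s u r = (f_dest f, f_upd f s.1.2 r, s.2 * f_wt f s.1.2 r)].
Proof.
case: s => [[l v] w] /= lout; have [wft _ _] := wfPi.
have [t [tE tin tl tv]] := enabled_some v lout.
have [_ _ fs0 _ _] := wft t tin.
have [f fE fin] := select_fork_some u 0 fs0.
exists t, f; split => //.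
by rewrite /step (introF eqP lout) tE fE.
Qed.

Lemma step_out (s : @wstate R n L) (u : R) (r : m.-tuple R) :
  s.1.1 = l_out Pi -> step Pi s u r = s.
Proof. by case: s => [[l v] w] /= ->; rewrite eqxx. Qed.

Definition scores_at_exit (M : R) := forall t f, List.In t (trans Pi) ->
  List.In f (t_forks t) -> forall v r,
  0 <= f_wt f v r <= M /\ (f_dest f <> l_out Pi -> f_wt f v r = 1).

(** An invariant of the run: the weight is 1 until the exit, so a single score, at most [M], ever
    enters the product. *)
Definition exit_weighted (M : R) (s : @wstate R n L) :=
  0 <= s.2 <= M /\ (s.1.1 <> l_out Pi -> s.2 = 1).

Lemma exit_weighted_step (M : R) (s : @wstate R n L) (u : R) (r : m.-tuple R) :
  scores_at_exit M -> exit_weighted M s -> exit_weighted M (step Pi s u r).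
Proof.
move=> scM [wM w1]; have [sout|sout] := pselect (s.1.1 = l_out Pi).
  by rewrite step_out.
have [t [f [tin _ fin ->]]] := step_move u r sout.
have [wtM wt1] := scM t f tin fin s.1.2 r.
by rewrite /exit_weighted /= w1// !mul1r.
Qed.

Lemma weighted_bounded (h : L -> n.-tuple R -> R) (M B : R)
    (s : @wstate R n L) :
  (forall l v, `|h l v| <= B) -> exit_weighted M s -> `|weighted h s| <= M * B.
Proof.
move=> hB [/andP[w0 wM] _]; rewrite /weighted normrM ler_pM//.
by rewrite ger0_norm.
Qed.

Context {d : measure_display} {Omega : measurableType d}.
Variables (Pr : probability Omega R) (U : nat -> Omega -> R)
          (X : nat -> 'I_m -> Omega -> R).

Lemma score_at_end_scores : score_at_end Pi Pr U X ->
  exists2 M : R, 1 <= M & scores_at_exit M.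
Proof.
move=> [_ [i [t0 [f0 [M [[t0i t0E] [f0out _] _ [M0 f0M] other]]]]]].
(* The bound must also cover the constant score 1 and the initial weight. *)
exists (Num.max 1 M); first by rewrite le_max lexx.
move=> t f tin fin v r; have [j tj] := List.In_nth_error _ _ tin.
have [ji|ji] := pselect (j = i).
  move: tj fin; rewrite ji t0i => -[<-]; rewrite t0E => -[<-|[]].
  split; last by rewrite f0out.
  by have /andP[-> /= wM] := f0M v r; rewrite le_max wM orbT.
have [fout wt1] := other j t tj ji f fin.
by split; rewrite wt1// ler01 le_max lexx.
Qed.

Lemma exit_weighted_run (M : R) l v k om :
  1 <= M -> scores_at_exit M -> exit_weighted M (run Pi U X l v k om).
Proof.
move=> M1 scM; elim: k => [|k IH]; last exact: exit_weighted_step.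
by split => //=; rewrite ler01.
Qed.

(** [reach_step] admits only samples in the support of the marginals, hence the condition on the
    whole noise sequence; [ae_noise_in_supp] makes it hold almost surely. *)
Lemma reachable_run v k om : in_supp_vec (mu_init Pi) v ->
  (forall j i, in_supp_R (distD Pi i) (X j i om)) ->
  let s := run Pi U X (l_init Pi) v k om in reachable Pi s.1.1 s.1.2.
Proof.
move=> vsupp Xsupp; elim: k => [|k IH] /=; first exact: reach_init.
have [sout|sout] := pselect ((run Pi U X (l_init Pi) v k om).1.1 = l_out Pi).
  by rewrite step_out.
have [t [f [tin [tl tv] fin ->]]] := step_move (U k om) (sample X k om) sout.
apply: reach_step IH sout tin tl tv fin _ => i.
by rewrite tnth_mktuple; exact: Xsupp.
Qed.

Hypothesis noiseP : noise_model Pi Pr U X.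

(** Each sample has law [distD Pi i], whose support has full measure, and there are only countably
    many samples. *)
Lemma ae_noise_in_supp :
  {ae Pr, forall om, forall j i, in_supp_R (distD Pi i) (X j i om)}.
Proof.
have [mN _ _ lawX] := noiseP.
apply: ae_foralln => j.
have H i : {ae Pr, forall om, in_supp_R (distD Pi i) (X j i om)}.
  have [N [mN0 N0 subN]] := ae_in_supp (distD Pi i).
  exists (X j i @^-1` N); split.
  - by rewrite -[X in measurable X]setTI; exact: (mN (j, Some i)).
  - by rewrite lawX.
  - by move=> om /= Hom; exact: subN.
exact: filter_forall.
Qed.

Lemma integral_weighted_step (h : L -> n.-tuple R -> R) (M B : R) l v k :
  1 <= M -> scores_at_exit M -> (forall l, measurable_fun setT (h l)) ->
  (forall l v, `|h l v| <= B) -> l <> l_out Pi ->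
  (\int[Pr]_om (weighted h (step Pi (l, v, 1%R) (U k om) (sample X k om)))%:E =
   ewt Pi Pr X h l v)%E.
Proof.
move=> M1 scM mh hB lout; have [mN _ lawU _] := noiseP.
have [wft _ _] := wfPi.
have [t [tE tin tl tv]] := enabled_some v lout.
have [_ _ fs0 p1 wff] := wft t tin.
pose phi (f : @fork R n m L) (r : m.-tuple R) :=
  f_wt f v r * h (f_dest f) (f_upd f v r).
rewrite /ewt (introF eqP lout) tE.
have phiP f : List.In f (t_forks t) -> [/\ 0 <= f_prob f,
    measurable_fun setT (phi f) & forall r, `|phi f r| <= M * B].
  move=> fin; have [/andP[p0 _] mupd mwt wt0] := wff f fin.
  split; [exact: ltW| |move=> r].
    have mv : measurable_fun setT (fun r : m.-tuple R => (v, r)).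
      exact: measurable_fun_pair.
    apply: measurable_funM; first exact: (measurableT_comp mwt mv).
    by apply: measurableT_comp; [exact: mh|exact: (measurableT_comp mupd mv)].
  have [/andP[w0 wM] _] := scM t f tin fin v r.
  by rewrite normrM ler_pM// ger0_norm.
have {}p1 : \sum_(f <- t_forks t) f_prob f = 1 - 0 by rewrite subr0.
have [ig <-] := integral_select_fork noiseP k phiP fs0 (lexx 0) p1.
have ms : measurable_fun setT
   (fun om => weighted h (step Pi (l, v, 1%R) (U k om) (sample X k om))).
  apply: measurable_weighted => //; apply: measurable_state_step => //.
  - exact: (mN (k, None)).
  - exact: measurable_sample noiseP k.
apply: ae_eq_integral => //.
- exact/measurable_EFinP.
- exact: measurable_int ig.
(* The two integrands can differ only where the test [0 <= U k] of [integral_select_fork] fails, a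
   null event since [U k] is uniform on the unit interval. *)
exists (U k @^-1` `]-oo, 0[%classic); split.
- by rewrite -[X in measurable X]setTI; apply: (mN (k, None)).
- apply: etrans (lawU k _ (measurable_itv _)) _.
  rewrite (_ : _ `&` _ = set0) ?measure0//.
  rewrite -subset0 => x [] /=; rewrite !in_itv/= => x0 /andP[].
  by rewrite leNgt x0.
move=> om /=; apply: contra_notP; rewrite in_itv/= => /negP.
rewrite -leNgt => u0 _; congr EFin.
have [f fE fin] := select_fork_some (U k om) 0 fs0.
by rewrite u0 fE /weighted /step (introF eqP lout) tE fE /= mul1r.
Qed.


Lemma run_out v om k k' : out_at Pi U X v om k -> (k <= k')%N ->
  run Pi U X (l_init Pi) v k' om = run Pi U X (l_init Pi) v k om.
Proof.
move=> /eqP kout /subnK <-; elim: (k' - k)%N => [//|j IH].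
by rewrite addSn /= IH step_out.
Qed.

(** * The expectations of [W k] along the run and their limit *)

Section expectation.
Variables (h : L -> n.-tuple R -> R) (M B : R) (v : n.-tuple R).
Hypotheses (M1 : 1 <= M) (scM : scores_at_exit M).
Hypotheses (mh : forall l, measurable_fun setT (h l)).
Hypothesis hB : forall l v, `|h l v| <= B.

Let W k om := weighted h (run Pi U X (l_init Pi) v k om).

Let measurable_run k : measurable_state (run Pi U X (l_init Pi) v k).
Proof. by apply: measurable_state_run => // j _; case: noiseP. Qed.

Let mW k : measurable_fun setT (W k).
Proof. exact: measurable_weighted. Qed.

Let WMB k om : `|W k om| <= M * B.
Proof. exact/weighted_bounded/exit_weighted_run. Qed.

Let iW k : Pr.-integrable setT (EFin \o W k).
Proof. exact: (bounded_integrable Pr (mW k) (WMB k)). Qed.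

(** The conditional expectation of [W k.+1] given the noise of the first [k] steps. Before the exit
    the weight is 1, so [ewt] appears without a factor. *)
Definition expected_next k om : \bar R :=
  let s := run Pi U X (l_init Pi) v k om in
  if s.1.1 == l_out Pi then (weighted h s)%:E else ewt Pi Pr X h s.1.1 s.1.2.

(* The state after [k] steps is a function of the noise of these steps, hence
   independent of the noise of step [k]. *)
Lemma integral_expected_next k :
  Pr.-integrable setT (expected_next k) /\
  (\int[Pr]_om (W k.+1 om)%:E = \int[Pr]_om expected_next k om)%E.
Proof.
(* [J1] indexes the noise of the steps before [k], [J2] that of step [k]. *)
pose J1 := [seq (j, o) | j <- iota 0 k, o <- enum {: option 'I_m}].
pose J2 := [seq (k, o) | o <- enum {: option 'I_m}].
pose T1 := g_sigma_algebraType (cylinders (noise U X) J1).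
pose T2 := g_sigma_algebraType (cylinders (noise U X) J2).
have uJ : uniq (J1 ++ J2).
  rewrite cat_uniq; apply/and3P; split.
  - by apply: allpairs_uniq; rewrite ?iota_uniq ?enum_uniq// => -[? ?] [].
  - apply/hasP => -[y /mapP[z _ yE]] /= /allpairsP[p [p1 _ pE]].
    move: p1; rewrite mem_iota add0n; move: pE; rewrite yE => -[<- _].
    by rewrite ltnn.
  - by rewrite map_inj_uniq ?enum_uniq// => o o' [].
have mN1 (j : nat * option 'I_m) : (j.1 < k)%N ->
    @measurable_fun _ _ T1 R setT (noise U X j).
  move=> jk; apply: (measurable_noise_cylinders (Y := noise U X)).
  by apply/allpairsP; exists j; rewrite mem_iota mem_enum; case: j jk.
have mN2 o : @measurable_fun _ _ T2 R setT (noise U X (k, o)).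
  apply: (measurable_noise_cylinders (Y := noise U X)).
  by apply/mapP; exists o; rewrite ?mem_enum.
have mS : @measurable_fun _ _ T2 _ setT (sample X k).
  apply/measurable_fun_tnthP => i.
  apply: (@eq_measurable_fun _ _ T2 R setT (X k i)); last exact: (mN2 (Some i)).
  by move=> x _; rewrite /= tnth_mktuple.
(* The past is read from the first argument and the noise of step [k] from the second; on the
   diagonal this is [W k.+1]. *)
pose g (x : T1 * T2) := weighted h
  (step Pi (run Pi U X (l_init Pi) v k x.1) (U k x.2) (sample X k x.2)).
have gMB x : `|g x| <= M * B.
  exact/weighted_bounded/exit_weighted_step/exit_weighted_run.
have mg : measurable_fun setT g.
  apply: measurable_weighted => //; apply: measurable_state_step => //.
  - have [ml mv mw] := @measurable_state_run _ _ _ _ _ wfPi _ T1 U X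
      (l_init Pi) v k mN1.
    split=> [l||].
    + exact: (measurableT_comp (ml l) measurable_fst).
    + exact: (measurableT_comp mv measurable_fst).
    + exact: (measurableT_comp mw measurable_fst).
  - exact: (measurableT_comp (mN2 None) measurable_snd).
  - exact: (measurableT_comp mS measurable_snd).
have [intE mE] := integral_indep_noise noiseP uJ mg gMB.
have nextE (om : Omega) :
    (\int[Pr]_om' (g (om, om'))%:E)%E = expected_next k om.
  (* At the exit the step is the identity and the integrand is constant; elsewhere the weight is 1,
     as [integral_weighted_step] requires. *)
  rewrite /g /expected_next /=; case: eqP => [sout|sout].
    under eq_integral do rewrite step_out//.
    by rewrite -[RHS]mule1 -(probability_setT Pr) -integral_cst.
  have [_ /(_ sout) w1] : exit_weighted M (run Pi U X (l_init Pi) v k om).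
    exact: exit_weighted_run.
  rewrite -(integral_weighted_step _ k M1 scM mh hB sout) -w1.
  by case: (run _ _ _ _ _ _ _) => -[].
split; last by rewrite intE; apply: eq_integral => om _; exact: nextE.
apply: (eq_integrable measurableT
    (fun om : Omega => \int[Pr]_om' (g (om, om'))%:E)%E) => [om _|].
  exact: nextE.
apply: (@ebounded_integrable _ _ _ _ (M * B)) => // om.
apply: abse_integral_le => //.
apply: measurable_weighted => //; apply: measurable_state_step => //.
- by split => [l||] /=; exact: measurable_cst.
- by case: noiseP => mN _ _ _; exact: (mN (k, None)).
- exact: measurable_sample noiseP k.
Qed.

Hypothesis vsupp : in_supp_vec (mu_init Pi) v.

Hypothesis h_out : forall w, reachable Pi (l_out Pi) w -> h (l_out Pi) w = 1.
Hypothesis ast : Pr [set om | exists k, out_at Pi U X v om k] = 1%E.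

Lemma cvg_integral_weighted :
  (\int[Pr]_om (W k om)%:E)%E @[k --> \oo] --> expected_weight Pi Pr U X v setT.
Proof.
rewrite /expected_weight; set F := (X in (\int[Pr]_om X om)%E).
have finalE om k : out_at Pi U X v om k ->
    F om = (run Pi U X (l_init Pi) v k om).2%:E.
  move=> kout; rewrite /F /final; case: pselect => [ex|[]]; last by exists k.
  case: ex_minnP => N Nout _ /=; rewrite (asboolT Logic.I).
  (* The first exit time [N] and the time [k] are both compared with their maximum, as the run is
     frozen from the exit on. *)
  by rewrite -(run_out Nout (leq_maxl N k)) (run_out kout (leq_maxr N k)).
have final0 om : ~ (exists k, out_at Pi U X v om k) -> F om = 0%E.
  by move=> nex; rewrite /F /final; case: pselect.
have eventually_out om k (P : nat -> Prop) : out_at Pi U X v om k ->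
    (forall j, out_at Pi U X v om j -> P j) -> \forall j \near \oo, P j.
  move=> kout outP; exists k => // j /= kj; apply: outP.
  by rewrite /out_at (run_out kout kj).
have mF : measurable_fun setT F.
  (* [F] involves an unbounded search for the exit time; it is the pointwise limit of the measurable
     [G k], each sequence being eventually constant. *)
  pose G k om := (if out_at Pi U X v om k then
    (run Pi U X (l_init Pi) v k om).2 else 0)%:E.
  apply: (emeasurable_fun_cvg G) => [k|om _].
    apply/measurable_EFinP; have [ml mv mw] := measurable_run k.
    by apply: measurable_fun_ifT => //; exact: ml.
  apply: cvg_near_cst.
  have [[k kout]|nex] := pselect (exists k, out_at Pi U X v om k).
    apply: eventually_out kout _ => j jout.
    by rewrite /G jout (finalE _ _ jout).
  apply: nearW => k; rewrite final0// /G.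
  by case: ifPn => // kout; case: nex; exists k.
have ae_out : {ae Pr, forall om, exists k, out_at Pi U X v om k}.
  have mout : measurable [set om | exists k, out_at Pi U X v om k].
    rewrite (_ : mkset _ = \bigcup_k [set om | out_at Pi U X v om k]).
      apply: bigcupT_measurable => k; have [ml _ _] := measurable_run k.
      have := ml (l_out Pi) measurableT [set true] Logic.I.
      by rewrite setTI.
    by apply/seteqP; split => om [k]; [exists k|move=> _ kout; exists k].
  exists (~` [set om | exists k, out_at Pi U X v om k]); split => //.
    exact: measurableC.
  by rewrite probability_setC// ast subee.
(* Almost every run exits, and does so in a reachable state, where [h] is 1; from then on [W] equals
   the final weight. *)
have cvgW : {ae Pr, forall om, setT om -> (W k om)%:E @[k --> \oo] --> F om}.
  apply: filterS2 ae_noise_in_supp ae_out => om Xsupp [k kout] _.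
  apply: cvg_near_cst; apply: eventually_out kout _ => j jout.
  rewrite (finalE _ _ jout) /W /weighted.
  have := reachable_run j vsupp Xsupp; rewrite /= (eqP jout) => /h_out ->.
  by rewrite mulr1.
have [|_ _] := dominated_convergence measurableT
  (fun k => (measurable_EFinP _ _).2 (mW k)) mF cvgW
  (finite_measure_integrable_cst Pr (M * B) measurableT).
  by apply: aeW => om k _; rewrite /= lee_fin.
exact.
Qed.

Lemma integral_weighted0 :
  (\int[Pr]_om (W 0 om)%:E = (h (l_init Pi) v)%:E)%E.
Proof.
rewrite -[RHS]mule1 -(probability_setT Pr) -integral_cst//.
by apply: eq_integral => om _; rewrite /W /weighted /= mul1r.
Qed.

(** By induction each [W k] has expectation at most its initial value: [expected_next] equals [W k]
    at the exit and is almost surely at most [W k] elsewhere. The bound passes to the limit. *)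
Lemma expected_weight_le :
  (forall l w, reachable Pi l w -> l <> l_out Pi ->
    (ewt Pi Pr X h l w <= (h l w)%:E)%E) ->
  (expected_weight Pi Pr U X v setT <= (h (l_init Pi) v)%:E)%E.
Proof.
move=> ewth; apply: cvge_le cvg_integral_weighted; apply: nearW.
elim=> [|k IH]; first by rewrite integral_weighted0.
have [iN ->] := integral_expected_next k.
apply: le_trans IH; apply: (ae_le_integral iN (iW k)).
apply: filterS ae_noise_in_supp => om Xsupp.
rewrite /expected_next; case: eqP => // sout.
have [_ /(_ sout) w1] := exit_weighted_run (l_init Pi) v k om M1 scM.
by rewrite /= /W /weighted w1 mul1r; apply: ewth => //; exact: reachable_run.
Qed.

Lemma expected_weight_ge :
  (forall l w, reachable Pi l w -> l <> l_out Pi ->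
    ((h l w)%:E <= ewt Pi Pr X h l w)%E) ->
  ((h (l_init Pi) v)%:E <= expected_weight Pi Pr U X v setT)%E.
Proof.
move=> ewth; apply: cvge_ge cvg_integral_weighted; apply: nearW.
elim=> [|k IH]; first by rewrite integral_weighted0.
have [iN ->] := integral_expected_next k.
apply: (le_trans IH); apply: (ae_le_integral (iW k) iN).
apply: filterS ae_noise_in_supp => om Xsupp.
rewrite /expected_next; case: eqP => // sout.
have [_ /(_ sout) w1] := exit_weighted_run (l_init Pi) v k om M1 scM.
by rewrite /= /W /weighted w1 mul1r; apply: ewth => //; exact: reachable_run.
Qed.

End expectation.
End steps.

Unset Implicit Arguments.
Set Strict Implicit.
Set Printing Implicit Defensive.

Theorem theorem4p2 (R : realType) (n m : nat) (L : finType)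
    (Pi : @wpts R n m L)
    (d : measure_display) (Omega : measurableType d) (Pr : probability Omega R)
    (U : nat -> Omega -> R) (X : nat -> 'I_m -> Omega -> R)
    (h : L -> n.-tuple R -> R) :
  wf_wpts Pi ->
  noise_model Pi Pr U X ->
  score_at_end Pi Pr U X ->
  (exists B : R, forall l v, `|h l v| <= B) ->
  (forall l, measurable_fun setT (h l)) ->
  (PUWF Pi Pr X h -> forall v, in_supp_vec (mu_init Pi) v ->
     (expected_weight Pi Pr U X v setT <= (h (l_init Pi) v)%:E)%E) /\
  (PLWF Pi Pr X h -> forall v, in_supp_vec (mu_init Pi) v ->
     ((h (l_init Pi) v)%:E <= expected_weight Pi Pr U X v setT)%E).
Proof.
move=> wfPi noiseP sae [B hB] mh.
have [M M1 scM] := score_at_end_scores sae.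
have [ast _] := sae.
split=> -[ewth h_out] v vsupp.
- exact: (expected_weight_le wfPi noiseP M1 scM mh hB vsupp h_out
    (ast v vsupp)).
- exact: (expected_weight_ge wfPi noiseP M1 scM mh hB vsupp h_out
    (ast v vsupp)).
Qed.
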